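(* Let $n$ be odd and let $G=K_n$ be the complete graph on $[n]$, with one variable $x_{ij}=x_{ji}$ for each edge. Consider the system $\sum_{j\in N(i)}x_{ij}-1=0$ for $i\in[n]$, and $x_{ij}x_{ik}=0$ for all $i$ and distinct $j,k\neq i$. This system is infeasible, and the Nullstellensatz certificate $\Delta_i$ ($i\in[n]$), $\Theta^i_{jk}$, with $1=\sum_i\Delta_i(\sum_{j\in N(i)}x_{ij}-1)+\sum\Theta^i_{jk}x_{ij}x_{ik}$, in which each $\Delta_i$ has degree equal to the size $\lfloor n/2\rfloor$ of a maximum matching of $K_n$, every matching monomial $\prod_{\{i,j\}\in M}x_{ij}$ appears with non-zero coefficient in every $\Delta_i$, and $\deg\Theta^i_{jk}\le\deg\Delta_\ell$ for all indices, is a Nullstellensatz certificate of minimal degree; in particular, the minimum degree of a Nullstellensatz certificate for this system is $\lfloor n/2\rfloor$.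
   Context: $N(i)$ denotes the neighborhood of vertex $i$. The degree of a Nullstellensatz certificate is the maximum of the degrees of its coefficient polynomials. (A certificate with the stated properties exists.) *)

(* Defs.v *)
From HB Require Import structures.
From mathcomp Require Import all_boot all_order all_algebra.
From mathcomp Require Import mpoly.

Set Implicit Arguments.
Unset Strict Implicit.
Unset Printing Implicit Defensive.

Import GRing.Theory.
Local Open Scope ring_scope.

Section Nullstellensatz.
Variables (F : fieldType) (N : nat) (I : finType).
Implicit Types (f c : I -> {mpoly F[N]}) (p : {mpoly F[N]}).

Definition infeasible f : Prop :=
  ~ exists v : 'I_N -> F, forall s : I, (f s).@[v] = 0.

Definition nss_certificate f c : Prop := 1 = \sum_(s : I) c s * f s.

(* [msize] is degree plus one, and 0 on the zero polynomial: here the zero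
   polynomial gets degree 0. *)
Definition mpdeg p : nat := (msize p).-1.

Definition nss_degree c : nat := \max_(s : I) mpdeg (c s).

Definition minimal_certificate f c : Prop :=
  nss_certificate f c /\
  forall c', nss_certificate f c' -> (nss_degree c <= nss_degree c')%N.

Definition minimum_degree f (d : nat) : Prop :=
  (exists2 c, nss_certificate f c & nss_degree c = d) /\
  forall c, nss_certificate f c -> (d <= nss_degree c)%N.

End Nullstellensatz.

Definition edge (n : nat) : finType := {e : {set 'I_n} | #|e| == 2}.

Definition nbhd (n : nat) (i : 'I_n) : {set 'I_n} := [set j | j != i].

Definition is_matching (n : nat) (M : {set edge n}) : bool :=
  [forall e in M, forall e' in M, (e != e') ==> [disjoint val e & val e']].

Definition matching_number (n : nat) : nat :=
  \max_(M : {set edge n} | is_matching M) #|M|.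

(* The indices (i, j, k) of the equations x_ij x_ik = 0; since
   x_ij x_ik = x_ik x_ij, each unordered pair {j, k} is taken once, as j < k. *)
Definition cherry (n : nat) : finType :=
  {t : 'I_n * 'I_n * 'I_n |
    [&& t.1.2 != t.1.1, t.2 != t.1.1 & (t.1.2 < t.2)%N]}.

Section PerfectMatching.
Variables (F : fieldType) (n : nat).


(* Variables are numbered by the edges, through [enum_rank].  The default
   value 0 is reached only for i = j, which never occurs below. *)
Definition xvar (i j : 'I_n) : {mpoly F[#|edge n|]} :=
  oapp (fun e : edge n => 'X_(enum_rank e)) 0 (insub [set i; j]).

Definition matching_system (s : 'I_n + cherry n) : {mpoly F[#|edge n|]} :=
  match s with
  | inl i => (\sum_(j in nbhd i) xvar i j) - 1
  | inr t => let: (i, j, k) := val t in xvar i j * xvar i k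
  end.

(* The exponent vector of the monomial \prod_(e in M) x_e. *)
Definition matching_mnm (M : {set edge n}) : 'X_{1..#|edge n|} :=
  (\sum_(e in M) U_(enum_rank e))%MM.

(* [c (inl i)] is Delta_i and [c (inr (i, j, k))] is Theta^i_jk. *)
Definition matching_certificate
    (c : 'I_n + cherry n -> {mpoly F[#|edge n|]}) : Prop :=
  [/\ nss_certificate matching_system c,
      forall i : 'I_n, mpdeg (c (inl i)) = matching_number n,
      forall (i : 'I_n) (M : {set edge n}),
        is_matching M -> (c (inl i))@_(matching_mnm M) != 0
    & forall (t : cherry n) (l : 'I_n),
        (mpdeg (c (inr t)) <= mpdeg (c (inl l)))%N].

End PerfectMatching.

(* Main.v *)
(* Modulo the cherries only the monomials x^a supported on matchings survive.

   Lower bound: let L(x^a) = w_k if the support of a is a matching of size k,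
   and 0 otherwise, where w_0 = 1 and (n - 1 - 2k) w_(k+1) = w_k.  A k-matching
   missing i extends by an edge at i in n - 1 - 2k ways, so L kills every
   x^a (\sum_j x_ij - 1) with deg a < n/2, and it kills all multiples of the
   cherries, whereas L(1) = 1.

   Existence: the sum of alpha_|M| x^M over the matchings M missing i, with
   alpha_0 = -1/n and (n - 2k) alpha_k = 2k alpha_(k-1), serves as Delta_i.
   The matchings M covering i are put in with coefficients opposite at the two
   ends of each edge e of M: modulo the cherries, x^M times the equation of an
   end of e is x^M (x_e - 1) for both ends, so that these terms cancel. *)

Require Import Defs.
From HB Require Import structures.
From mathcomp Require Import all_boot all_order all_algebra.
From mathcomp Require Import mpoly.
From mathcomp Require Import zify.

Set Implicit Arguments.
Unset Strict Implicit.
Unset Printing Implicit Defensive.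

Import GRing.Theory.
Local Open Scope ring_scope.

(** * Matchings of K_n: covered vertices, sizes and a double count *)

Section Matchings.
Variable n : nat.
Implicit Types (M : {set edge n}) (e : edge n) (i j : 'I_n).

Definition covered M : {set 'I_n} := cover (val @: M).

Lemma coveredP M i :
  reflect (exists2 e, e \in M & i \in val e) (i \in covered M).
Proof.
apply: (iffP bigcupP) => [[A /imsetP[e eM ->] ie]|[e eM ie]]; first by exists e.
by exists (val e); rewrite ?imset_f.
Qed.

Lemma matchingP M :
  reflect {in M &, forall e e', e != e' -> [disjoint val e & val e']}
          (is_matching M).
Proof.
apply: (iffP forall_inP) => [H e e' eM e'M|H e eM].
  by move/forall_inP: (H e eM) => /(_ e' e'M) /implyP.
by apply/forall_inP => e' e'M; apply/implyP; apply: H.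
Qed.

Lemma matching_shared M e e' i : is_matching M -> e \in M -> e' \in M ->
  i \in val e -> i \in val e' -> e = e'.
Proof.
move=> /matchingP mM eM e'M ie ie'; apply/eqP; apply: contraTT ie' => ne.
by rewrite (disjointFr (mM _ _ eM e'M ne) ie).
Qed.

Lemma not_disjoint_shared (A B : {set 'I_n}) :
  ~~ [disjoint A & B] -> exists2 i, i \in A & i \in B.
Proof. by case/pred0Pn => i /andP[iA iB]; exists i. Qed.

Lemma sub_matching M M' : M \subset M' -> is_matching M' -> is_matching M.
Proof.
move=> /subsetP sM /matchingP mM'; apply/matchingP => e e' /sM eM /sM e'M.
exact: mM'.
Qed.

Lemma matching0 : is_matching (set0 : {set edge n}).
Proof. by apply/matchingP => e e'; rewrite inE. Qed.

Lemma matchingU1 M e : is_matching M -> [disjoint val e & covered M] ->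
  is_matching (e |: M).
Proof.
move=> /matchingP mM de.
have dis e' : e' \in M -> [disjoint val e & val e'].
  move=> e'M; apply: disjointWr de; apply/subsetP => i ie'.
  by apply/coveredP; exists e'.
apply/matchingP => f f' /setU1P[->|fM] /setU1P[->|f'M] ne.
- by rewrite eqxx in ne.
- exact: dis.
- by rewrite disjoint_sym dis.
- exact: mM.
Qed.

Lemma matchingU1_disjoint M e : e \notin M -> is_matching (e |: M) ->
  [disjoint val e & covered M].
Proof.
move=> eM meM; apply: contraNT eM => /not_disjoint_shared[i ie /coveredP[e' e'M ie']].
by rewrite (matching_shared meM _ _ ie ie') ?inE ?eqxx ?e'M ?orbT.
Qed.

Lemma matching_trivIset M : is_matching M -> trivIset (val @: M).
Proof.
move=> mM; apply/trivIsetP => _ _ /imsetP[e eM ->] /imsetP[e' e'M ->] ne.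
by move/matchingP: mM; apply=> //; apply: contraNneq ne => ->.
Qed.

Lemma card_covered M : is_matching M -> #|covered M| = (2 * #|M|)%N.
Proof.
move=> mM; rewrite mulnC -(card_imset (mem M) val_inj).
apply: card_uniform_partition => [A /imsetP[e _ ->]|]; first by case: e => B /= /eqP.
apply/and3P; split=> //; first exact: matching_trivIset.
by apply/imsetP => -[[A /= A2] _ A0]; move: A2; rewrite -A0 cards0.
Qed.

Lemma sum_covered (V : nmodType) (G : 'I_n -> V) M : is_matching M ->
  \sum_(i in covered M) G i = \sum_(e in M) \sum_(i in val e) G i.
Proof.
move=> mM; rewrite big_trivIset ?matching_trivIset //=.
by rewrite big_imset //= => e e' _ _; apply: val_inj.
Qed.

(** Double counting: a matching with a marked edge is the same as a smaller matching with an edge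
    added to it, so each matching arises once for each of its edges. *)
Lemma sum_matchingU1 (V : nmodType) (G : {set edge n} -> V) :
  \sum_(M | is_matching M)
      \sum_(e | (e \notin M) && is_matching (e |: M)) G (e |: M) =
  \sum_(M | is_matching M) G M *+ #|M|.
Proof.
under [RHS]eq_bigr => M _ do rewrite -sumr_const.
rewrite (exchange_big_dep predT) //= [RHS](exchange_big_dep predT) //=.
apply: eq_bigr => e _.
rewrite [RHS](reindex_onto (fun M => e |: M) (fun M => M :\ e)) => [|M /andP[_ eM]]; last first.
  exact: setD1K.
apply: eq_bigl => M; rewrite setU11 andbT.
(* Only sets without [e] arise by deleting [e], and a subset of a matching is a matching, so the two
   filters agree. *)
case: (boolP (e \in M)) => eM /=.
  rewrite andbF; apply/esym/negbTE; rewrite negb_and orbC; apply/orP; left.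
  by apply: contraTneq eM => <-; rewrite setD11.
rewrite setU1K // eqxx andbT; case: (boolP (is_matching (e |: M))) => [/sub_matching mM|].
  by rewrite mM // subsetUr.
by rewrite andbF.
Qed.

Lemma matching_card_le M : is_matching M -> (#|M| <= n./2)%N.
Proof.
move=> /card_covered cM; have := max_card (mem (covered M)).
by rewrite card_ord cM; lia.
Qed.

(** Greedy extension: fewer than [n./2] disjoint edges leave at least two vertices uncovered, and in
    K_n these span an edge. *)
Lemma exists_matching k : (k <= n./2)%N -> exists2 M : {set edge n}, is_matching M & #|M| = k.
Proof.
elim: k => [|k IHk] kn; first by exists set0; [exact: matching0 | rewrite cards0].
have [M mM cM] := IHk (ltnW kn).
have : (1 < #|~: covered M|)%N.
  have := cardsC (covered M); rewrite card_ord card_covered // cM.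
  by move: kn; lia.
case/card_gt1P => i [j [iM jM ij]].
have e2 : #|[set i; j]| == 2 by rewrite cards2 ij.
pose e : edge n := exist (fun A : {set 'I_n} => #|A| == 2) _ e2.
have de : [disjoint val e & covered M].
  rewrite disjoints_subset; apply/subsetP => l; rewrite !inE in iM jM *.
  by case/orP => /eqP->.
exists (e |: M); first exact: matchingU1.
suff eM : e \notin M by rewrite cardsU1 cM eM.
apply/negP => eM; have := disjointFr de (x := i).
rewrite !inE eqxx => /(_ isT)/negP; apply.
by apply/coveredP; exists e; rewrite // !inE eqxx.
Qed.

Lemma matching_numberE : matching_number n = n./2.
Proof.
apply/eqP; rewrite eqn_leq; apply/andP; split.
  by apply/bigmax_leqP => M; apply: matching_card_le.
have [M mM <-] := exists_matching (leqnn n./2).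
exact: (leq_bigmax_cond (F := fun M : {set edge n} => #|M|)).
Qed.

Lemma edge_pair e : exists i j, i != j /\ val e = [set i; j].
Proof. by apply/cards2P; case: e. Qed.

Lemma edge_at e i : i \in val e -> exists2 j, j != i & val e = [set i; j].
Proof.
have [k [l [kl ->]]] := edge_pair e; rewrite !inE => /orP[] /eqP ->.
  by exists l; rewrite // eq_sym.
by exists k; rewrite // setUC.
Qed.

(** The neighbours j of i correspond to the edges at i; this passes from the variables x_ij to
    variables indexed by edges. The default 0 is not reached, since j differs from i. *)
Lemma sum_nbhd (V : nmodType) (G : edge n -> V) i :
  \sum_(j in nbhd i) oapp G 0 (insub [set i; j]) = \sum_(e : edge n | i \in val e) G e.
Proof.
transitivity (\sum_(j in nbhd i) \sum_(e : edge n | val e == [set i; j]) G e).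
  apply: eq_bigr => j; rewrite inE eq_sym => ij.
  case: insubP => [e _ /= <-|]; last by rewrite cards2 ij.
  by rewrite (big_pred1 e) // => e'; rewrite -val_eqE.
rewrite (exchange_big_dep (fun e : edge n => i \in val e)) => [|j e _ /eqP->]; last first.
  by rewrite !inE eqxx.
have one (l : 'I_n) (c : V) : l != i ->
    \sum_(j in nbhd i | [set i; l] == [set i; j]) c = c.
  move=> li; apply: (big_pred1 l) => j; rewrite inE; apply/andP/eqP => [[ji]|->] //.
  by move=> /eqP/setP/(_ j); rewrite !inE eqxx orbT (negPf ji) /= => /eqP.
by apply: eq_bigr => e /edge_at[l li ->]; rewrite one.
Qed.

End Matchings.

(** * Lower bound on the degree: the functional L *)

Section LowerBound.
Variables (F : fieldType) (n : nat).
Implicit Types (M S : {set edge n}) (e : edge n) (i j : 'I_n).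
Implicit Types (a b : 'X_{1..#|edge n|}).
Local Notation poly := {mpoly F[#|edge n|]}.
Implicit Types p q : poly.

Definition edge_var e : poly := 'X_(enum_rank e).

Lemma vertex_equationE i :
  matching_system F (inl i) = \sum_(e : edge n | i \in val e) edge_var e - 1.
Proof. by congr (_ - 1); exact: sum_nbhd. Qed.

Lemma xvarE e i j : val e = [set i; j] -> xvar F i j = edge_var e.
Proof. by move=> E; rewrite /xvar -E valK. Qed.

Lemma cherry_equationE (t : cherry n) : exists e e' i,
  [/\ e != e', i \in val e, i \in val e' &
      matching_system F (inr t) = edge_var e * edge_var e'].
Proof.
case: t => [[[i j] k] /= ijk]; have /and3P[/= ji ki jk] := ijk.
have pair2 l : l != i -> #|[set i; l]| == 2 by rewrite cards2 eq_sym => ->.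
exists (exist (fun A : {set 'I_n} => #|A| == 2) _ (pair2 _ ji)).
exists (exist (fun A : {set 'I_n} => #|A| == 2) _ (pair2 _ ki)).
exists i; split; rewrite ?inE ?eqxx //.
  rewrite -val_eqE /=; apply/eqP => /setP/(_ j); rewrite !inE eqxx orbT (negPf ji).
  by move=> /esym/eqP jk'; rewrite jk' ltnn in jk.
by congr (_ * _); apply: xvarE.
Qed.

(** The two ends other than i are distinct; the smaller one comes first in the cherry, and
    commutativity absorbs a swap. *)
Lemma cherry_of_edges e e' i : e != e' -> i \in val e -> i \in val e' ->
  exists t : cherry n, matching_system F (inr t) = edge_var e * edge_var e'.
Proof.
move=> ne /edge_at[j ji ej] /edge_at[k ki e'k].
have [jk|kj|jk] := ltngtP j k.
- have H : [&& (i, j, k).1.2 != (i, j, k).1.1, (i, j, k).2 != (i, j, k).1.1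
          & ((i, j, k).1.2 < (i, j, k).2)%N] by rewrite ji ki.
  exists (Sub (i, j, k) H).
  by rewrite /matching_system SubK (xvarE ej) (xvarE e'k).
- have H : [&& (i, k, j).1.2 != (i, k, j).1.1, (i, k, j).2 != (i, k, j).1.1
          & ((i, k, j).1.2 < (i, k, j).2)%N] by rewrite ji ki.
  exists (Sub (i, k, j) H).
  by rewrite /matching_system SubK (xvarE ej) (xvarE e'k) mulrC.
by case/eqP: ne; apply: val_inj; rewrite ej e'k (val_inj jk).
Qed.

Definition edge_supp a : {set edge n} := [set e | a (enum_rank e) != 0%N].

Lemma edge_supp0 : edge_supp 0%MM = set0.
Proof. by apply/setP => e; rewrite !inE mnm0E. Qed.

Lemma edge_suppU1 e a : edge_supp (U_(enum_rank e) + a)%MM = e |: edge_supp a.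
Proof.
apply/setP => f; rewrite !inE mnmDE mnm1E (inj_eq enum_rank_inj) (eq_sym e).
by case: (f == e).
Qed.

Lemma card_edge_supp a : (#|edge_supp a| <= mdeg a)%N.
Proof.
rewrite mdegE (reindex _ (onW_bij _ (@enum_rank_bij (edge n)))) /=.
rewrite -sum1_card big_mkcond /=; apply: leq_sum => e _.
by rewrite inE; case: (a _).
Qed.

Lemma mnm_matchingE M e : matching_mnm M (enum_rank e) = (e \in M).
Proof.
rewrite /matching_mnm mnm_sumE.
under eq_bigr => f _ do rewrite mnm1E (inj_eq enum_rank_inj).
case: (boolP (e \in M)) => eM.
  by rewrite (bigD1 e) //= eqxx big1 // => f /andP[_ /negPf->].
by rewrite big1 // => f fM; case: eqP => // fe; rewrite -fe fM in eM.
Qed.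

Lemma matching_mnm_inj : injective (@matching_mnm n).
Proof.
move=> M M' E; apply/setP => e.
by have := mnm_matchingE M e; rewrite E mnm_matchingE; do 2!case: (e \in _).
Qed.

Lemma mdeg_matching_mnm M : mdeg (matching_mnm M) = #|M|.
Proof.
by rewrite /matching_mnm mdeg_sum (eq_bigr (fun _ => 1%N)) ?sum1_card // => e _; rewrite mdeg1.
Qed.

(** The solution w_k of the recursion. Up to k = [n./2], the largest size of a matching, no factor n
    - 1 - 2l is zero. *)
Definition weight k : F := \prod_(l < k) ((n.-1 - 2 * l)%:R)^-1.

Definition matching_weight S : F := if is_matching S then weight #|S| else 0.

(** The functional L, truncated to monomials of degree below [d] so that the sum is finite. *)
Definition design d p : F :=
  \sum_(a : 'X_{1..#|edge n| < d}) p@_a * matching_weight (edge_supp a).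

Lemma design_sum d (I : Type) (r : seq I) (P : pred I) (G : I -> poly) :
  design d (\sum_(s <- r | P s) G s) = \sum_(s <- r | P s) design d (G s).
Proof.
rewrite [RHS]exchange_big /=; apply: eq_bigr => a _.
by rewrite raddf_sum mulr_suml.
Qed.

Lemma designD d p q : design d (p + q) = design d p + design d q.
Proof. by rewrite -big_split; apply: eq_bigr => a _; rewrite mcoeffD mulrDl. Qed.

Lemma designZ d (c : F) p : design d (c *: p) = c * design d p.
Proof. by rewrite mulr_sumr; apply: eq_bigr => a _; rewrite mcoeffZ mulrA. Qed.

Lemma designX d b :
  design d 'X_[b] = if (mdeg b < d)%N then matching_weight (edge_supp b) else 0.
Proof.
case: ifPn => [bd|]; last first.
  move=> db; apply: big1 => a _; rewrite mcoeffX; case: eqP => [E|]; last by rewrite mul0r.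
  by move: db; rewrite E bmdeg.
rewrite /design (bigD1 (BMultinom bd)) //= mcoeffX eqxx mul1r big1 ?addr0 // => a.
by rewrite mcoeffX -val_eqE /= eq_sym => /negPf->; rewrite mul0r.
Qed.

Lemma matching_weight_shared S e e' i : e != e' -> e \in S -> e' \in S ->
  i \in val e -> i \in val e' -> matching_weight S = 0.
Proof.
move=> ne eS e'S ie ie'; rewrite /matching_weight; case: ifP => // mS.
by rewrite (matching_shared mS eS e'S ie ie') eqxx in ne.
Qed.

Hypothesis F_char0 : [pchar F] =i pred0.

Lemma natr_neq0 k : (0 < k)%N -> k%:R != 0 :> F.
Proof. by move=> k0; move/pcharf0P: F_char0 => ->; rewrite -lt0n. Qed.

(** The identity that makes L kill x^a (\sum_j x_ij - 1), with [S] the support of a. *)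
Lemma sum_matching_weight S i : (#|S| < n./2)%N ->
  \sum_(e : edge n | i \in val e) matching_weight (e |: S) = matching_weight S.
Proof.
move=> Sn; case: (boolP (is_matching S)) => [mS|nmS]; last first.
  rewrite /matching_weight (negPf nmS) big1 // => e _; case: ifP => // /sub_matching.
  by move/(_ _ (subsetUr _ _)); rewrite (negPf nmS).
(* If [e0] in [S] covers [i], it alone contributes: [e0 |: S] is [S], and any other edge at [i]
   meets [e0]. *)
case: (boolP (i \in covered S)) => [/coveredP[e0 e0S ie0]|iS].
  rewrite (bigD1 e0) //= big1 => [|e /andP[ie ne]].
    by rewrite addr0 (setUidPr _) // sub1set.
  by apply: (matching_weight_shared ne _ _ ie ie0); rewrite !inE ?eqxx ?e0S ?orbT.
(* If [i] is uncovered, the edges {i, j} that contribute are those with j uncovered. Their number n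
   - 1 - 2|S| is positive as |S| < [n./2], and the recursion for the weights applies. *)
rewrite -(sum_nbhd (fun e => matching_weight (e |: S))).
rewrite (eq_bigr (fun j => if j \notin covered S then weight #|S|.+1 else 0)) => [|j].
  rewrite -big_mkcondr /= sumr_const.
  have -> : #|[pred j in nbhd i | j \notin covered S]| = (n.-1 - 2 * #|S|)%N.
    have := cardsC (i |: covered S); rewrite card_ord cardsU1 iS card_covered //.
    have -> : #|[pred j in nbhd i | j \notin covered S]| = #|~: (i |: covered S)|.
      by apply: eq_card => j; rewrite !inE negb_or.
    lia.
  rewrite /matching_weight mS /weight big_ord_recr /= -[LHS]mulr_natr -mulrA mulVf ?mulr1 //.
  by apply: natr_neq0; move: #|S| Sn => s; lia.
rewrite inE eq_sym => ij; case: insubP => [e _ ee|]; last by rewrite cards2 ij.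
have ie : i \in val e by rewrite ee !inE eqxx.
have je : j \in val e by rewrite ee !inE eqxx orbT.
rewrite /=.
have eS : e \notin S by apply: contra iS => eS; apply/coveredP; exists e.
rewrite /matching_weight cardsU1 eS add1n; case: ifP => [meS|nmeS].
  by rewrite (disjointFr (matchingU1_disjoint eS meS) je).
case: ifP => // jS; case/negP: nmeS; apply: matchingU1 => //.
rewrite ee disjoints_subset; apply/subsetP => l; rewrite !inE.
by case/orP => /eqP->.
Qed.

(** As [msize] is the degree plus one, [p] has degree below [n./2], and the product stays within the
    truncation at [n./2.+1]. *)
Lemma design_vertex p i : (msize p <= n./2)%N ->
  design n./2.+1 (p * matching_system F (inl i)) = 0.
Proof.
move=> pn; rewrite {1}[p]mpolyE mulr_suml big_seq design_sum big1 // => a ap.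
have an : (mdeg a < n./2)%N := leq_trans (msize_mdeg_lt ap) pn.
rewrite -scalerAl designZ vertex_equationE mulrBr mulr1 -[- 'X_[a]]scaleN1r.
rewrite designD designZ mulN1r designX (leq_trans an) //.
rewrite mulr_sumr design_sum -(sum_matching_weight i); last first.
  exact: leq_ltn_trans (card_edge_supp a) an.
rewrite [X in X - _](eq_bigr (fun e => matching_weight (e |: edge_supp a))).
  by rewrite subrr mulr0.
by move=> e _; rewrite mulrC -mpolyXD designX edge_suppU1 mdegD mdeg1 add1n ltnS an.
Qed.

Lemma design_cherry d p (t : cherry n) :
  design d (p * matching_system F (inr t)) = 0.
Proof.
have [e [e' [i [ne ie ie' ->]]]] := cherry_equationE t.
rewrite [p]mpolyE mulr_suml design_sum big1 // => a _.
rewrite -scalerAl designZ -!mpolyXD designX addmC -addmA !edge_suppU1.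
by rewrite (matching_weight_shared ne _ _ ie ie') ?if_same ?mulr0 // !inE eqxx ?orbT.
Qed.

Theorem certificate_degree_ge c :
  nss_certificate (matching_system F (n := n)) c -> (n./2 <= nss_degree c)%N.
Proof.
move=> /(congr1 (design n./2.+1)); rewrite design_sum -mpolyX0 designX mdeg0 edge_supp0.
rewrite /matching_weight matching0 cards0 /weight big_ord0 => E.
(* In smaller degree L would send the right-hand side to 0, but it sends 1 to w_0 = 1. *)
rewrite leqNgt; apply/negP => dc; move: E; rewrite big1 => [/eqP|[i|t] _].
- by rewrite oner_eq0.
- apply: design_vertex; move: (leq_ltn_trans (leq_bigmax (inl i)) dc).
  by rewrite /mpdeg; case: (msize _).
- exact: design_cherry.
Qed.

End LowerBound.

(** * Existence: a certificate of degree [n./2] *)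

Section Certificate.
Variables (F : fieldType) (n : nat).
Implicit Types (M : {set edge n}) (e : edge n) (i j : 'I_n).
Local Notation poly := {mpoly F[#|edge n|]}.
Implicit Types p q : poly.

(** Membership in the ideal of the cherries with coefficients of degree at most [d]; the bound later
    controls the degrees of the Theta. *)
Definition cherry_span d p : Prop :=
  exists2 c : cherry n -> poly, forall t, (msize (c t) <= d.+1)%N &
    p = \sum_t c t * matching_system F (inr t).

Lemma cherry_span0 d : cherry_span d 0.
Proof.
exists (fun _ => 0) => [t|]; first by rewrite msize0.
by rewrite big1 // => t _; rewrite mul0r.
Qed.

Lemma cherry_spanD d p q :
  cherry_span d p -> cherry_span d q -> cherry_span d (p + q).
Proof.
move=> [c cd ->] [c' cd' ->]; exists (fun t => c t + c' t) => [t|].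
  by apply: leq_trans (msizeD_le _ _) _; rewrite geq_max cd cd'.
by rewrite -big_split; apply: eq_bigr => t _; rewrite mulrDl.
Qed.

Lemma cherry_spanZ d a p : cherry_span d p -> cherry_span d (a *: p).
Proof.
move=> [c cd ->]; exists (fun t => a *: c t) => [t|].
  exact: leq_trans (msizeZ_le _ _) (cd t).
by rewrite scaler_sumr; apply: eq_bigr => t _; rewrite scalerAl.
Qed.

Lemma cherry_span_sum d (I : finType) (P : pred I) (G : I -> poly) :
  (forall s, P s -> cherry_span d (G s)) -> cherry_span d (\sum_(s | P s) G s).
Proof.
by move=> GJ; apply: big_ind => //; [exact: cherry_span0 | exact: cherry_spanD].
Qed.

Lemma cherry_span_le d d' p :
  (d <= d')%N -> cherry_span d p -> cherry_span d' p.
Proof. by move=> dd [c cd ->]; exists c => // t; apply: leq_trans (cd t) _. Qed.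

Lemma cherry_span_edges d p e e' i : (msize p <= d.+1)%N -> e != e' ->
  i \in val e -> i \in val e' ->
  cherry_span d (p * (edge_var F e * edge_var F e')).
Proof.
move=> pd ne ie ie'; have [t <-] := cherry_of_edges F ne ie ie'.
exists (fun t' => if t' == t then p else 0) => [t'|].
  by case: ifP; rewrite ?msize0.
rewrite (bigD1 t) //= eqxx big1 ?addr0 // => t' /negPf ->.
by rewrite mul0r.
Qed.

Definition matching_mono M : poly := 'X_[matching_mnm M].

Lemma matching_monoU1 M e : e \notin M ->
  matching_mono (e |: M) = matching_mono M * edge_var F e.
Proof.
by move=> eM; rewrite /matching_mono /matching_mnm big_setU1 //= mpolyXD mulrC.
Qed.

(** With e' removed from M, the rest of x^M has degree below |M| and multiplies the cherry x_e'
    x_e. *)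
Lemma cherry_span_matching M e e' i : e != e' -> e' \in M ->
  i \in val e -> i \in val e' ->
  cherry_span #|M| (matching_mono M * edge_var F e).
Proof.
move=> ne e'M ie ie'; rewrite -(setD1K e'M) matching_monoU1 ?setD11 //.
rewrite -mulrA [X in _ * X]mulrC; apply: cherry_span_edges ne ie ie'.
rewrite msizeX mdeg_matching_mnm ltnS cardsU1; exact: leq_addl.
Qed.

(** The numbers alpha_k. For odd n the denominators n - 2k with k <= [n./2] are odd, hence non-zero
    in characteristic 0. *)
Fixpoint free_coef k : F :=
  if k is k'.+1 then free_coef k' *+ 2 *+ k / (n - 2 * k)%:R else - (n%:R)^-1.

(** A covered vertex gets 1 at the smaller end of its edge in [M] and -1 at the larger end: opposite
    values, and non-zero so that every matching monomial occurs in every Delta_i. *)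
Definition delta_coef i M : F :=
  if i \notin covered M then free_coef #|M| else
  if [exists e in M, (i \in val e) && [exists j in val e, (i < j)%N]] then 1 else -1.

Lemma sum_delta_coef_edge M e : is_matching M -> e \in M ->
  \sum_(i in val e) delta_coef i M = 0.
Proof.
move=> mM eM.
have sum2 i j : (i < j)%N -> val e = [set i; j] -> \sum_(l in val e) delta_coef l M = 0.
  move=> ij ee; have ne : i != j by apply: contraTneq ij => ->; rewrite ltnn.
  rewrite ee big_setU1 ?inE //= big_set1 /delta_coef.
  have ie : i \in val e by rewrite ee !inE eqxx.
  have je : j \in val e by rewrite ee !inE eqxx orbT.
  have cov l : l \in val e -> l \in covered M by move=> le; apply/coveredP; exists e.
  rewrite !cov //=; case: ifPn => [_|/negP[]]; last first.
    apply/existsP; exists e; rewrite eM ie /=.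
    by apply/existsP; exists j; rewrite je.
  (* An edge of [M] through the larger end [j] is [e] itself, which has no vertex above [j]; so [j]
     gets -1. *)
  case: ifPn => [/exists_inP[e' e'M /andP[je' /exists_inP[l]]]|_]; last exact: subrr.
  rewrite -(matching_shared mM eM e'M je je') ee !inE.
  by case/orP => /eqP ->; [rewrite ltnNge ltnW | rewrite ltnn].
have [i [j [ij ee]]] := edge_pair e; move: ij; rewrite neq_ltn => /orP[] ij.
  exact: sum2 ij ee.
by apply: sum2 ij _; rewrite setUC.
Qed.

(** Covered vertices cancel in pairs along the edges of [M]; each of the n - 2|M| uncovered ones
    contributes alpha_|M|. *)
Lemma sum_delta_coef M : is_matching M ->
  \sum_i delta_coef i M = (n - 2 * #|M|)%:R * free_coef #|M|.
Proof.
move=> mM; rewrite (bigID (mem (covered M))) /= sum_covered //.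
rewrite big1 ?add0r => [|e eM]; last exact: sum_delta_coef_edge.
rewrite (eq_bigr (fun=> free_coef #|M|)) => [|i iM]; last by rewrite /delta_coef iM.
rewrite sumr_const mulr_natl -card_covered //; congr (_ *+ _).
rewrite -[X in (X - _)%N]card_ord -(cardsC (covered M)) addKn.
by apply: eq_card => i; rewrite !inE.
Qed.

Definition delta i : poly :=
  \sum_(M | is_matching M) delta_coef i M *: matching_mono M.

Lemma mcoeff_delta i M : is_matching M ->
  (delta i)@_(matching_mnm M) = delta_coef i M.
Proof.
move=> mM; rewrite raddf_sum (bigD1 M) //= big1 => [|M' /andP[_ ne]].
  by rewrite addr0 mcoeffZ mcoeffX eqxx mulr1.
by rewrite mcoeffZ mcoeffX (inj_eq (@matching_mnm_inj n)) (negPf ne) mulr0.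
Qed.

Lemma msize_delta_le i : (msize (delta i) <= n./2.+1)%N.
Proof.
apply: leq_trans (msize_sum _ _ _) _; apply/bigmax_leqP => M mM.
apply: leq_trans (msizeZ_le _ _) _.
by rewrite msizeX mdeg_matching_mnm ltnS matching_card_le.
Qed.

Hypothesis F_char0 : [pchar F] =i pred0.
Hypothesis n_odd : odd n.

Lemma free_coef_neq0 k : (k <= n./2)%N -> free_coef k != 0.
Proof.
elim: k => [|k IHk] kn /=.
  by rewrite oppr_eq0 invr_eq0 natr_neq0 //; case: n n_odd.
rewrite mulf_neq0 ?invr_eq0 ?natr_neq0 //; last by move: n_odd kn; lia.
rewrite -mulrnA -mulr_natr mulf_neq0 ?IHk ?natr_neq0 //; exact: ltnW.
Qed.

Lemma delta_coef_neq0 i M : is_matching M -> delta_coef i M != 0.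
Proof.
move=> mM; rewrite /delta_coef; case: ifP => _; last first.
  by case: ifP; rewrite ?oppr_eq0 oner_eq0.
exact: free_coef_neq0 (matching_card_le mM).
Qed.

(** The balance at a matching of size k: 2k alpha_(k-1) comes from its k submatchings with one edge
    less, and (n - 2k) alpha_k from the constants -1 of the equations. At k = 0 the predecessor is
    harmless, being multiplied by 0. *)
Lemma free_coef_rec k : (k <= n./2)%N ->
  free_coef k.-1 *+ 2 *+ k - (n - 2 * k)%:R * free_coef k = (k == 0)%:R.
Proof.
case: k => [|k] kn /=.
  by rewrite mulr0n muln0 subn0 sub0r mulrN opprK mulfV // natr_neq0 //; case: n n_odd.
by rewrite mulrC divfK ?subrr // natr_neq0 //; move: n_odd kn; lia.
Qed.

(** The contribution of a single [M] modulo the cherries: besides x^M itself, only edges disjoint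
    from [M] survive, with alpha_|M| from each of their two ends. *)
Lemma delta_matching_reduction M : is_matching M ->
  cherry_span n./2
    (\sum_i delta_coef i M *: (matching_mono M * matching_system F (inl i))
     - (\sum_(e | (e \notin M) && is_matching (e |: M))
          (free_coef #|M| *+ 2) *: matching_mono (e |: M)
        - ((n - 2 * #|M|)%:R * free_coef #|M|) *: matching_mono M)).
Proof.
move=> mM; rewrite -sum_delta_coef //.
(* Grouped by edges: x^M x_e collects the coefficients of both ends of e. *)
have -> : \sum_i delta_coef i M *: (matching_mono M * matching_system F (inl i)) =
    \sum_(e : edge n) (\sum_(i in val e) delta_coef i M) *: (matching_mono M * edge_var F e)
    - (\sum_i delta_coef i M) *: matching_mono M.
  rewrite [in X in _ - X]scaler_suml.
  under [X in X - _]eq_bigr => e _ do rewrite scaler_suml.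
  rewrite (exchange_big_dep predT) //= -sumrB; apply: eq_bigr => i _.
  rewrite -scaler_sumr -mulr_sumr -scalerBr; congr (_ *: _).
  by rewrite -/(matching_system F (inl i)) vertex_equationE mulrBr mulr1.
rewrite opprB addrA addrNK [X in _ - X]big_mkcond -sumrB /=.
(* For [e] in [M] the two signs cancel; for [e] disjoint from [M] both ends are uncovered; any other
   [e] meets an edge of [M], so that x^M x_e contains a cherry. *)
apply: cherry_span_sum => e _; case: (boolP (e \in M)) => /= eM.
  by rewrite sum_delta_coef_edge // scale0r subr0; apply: cherry_span0.
case: ifPn => [meM|nmeM].
  rewrite matching_monoU1 // (eq_bigr (fun=> free_coef #|M|)) => [|i ie].
    have /eqP e2 : #|val e| == 2 by case: e {meM eM}.
    by rewrite sumr_const e2 subrr; apply: cherry_span0.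
  by rewrite /delta_coef (disjointFr (matchingU1_disjoint eM meM) ie).
rewrite subr0; apply: cherry_spanZ; apply: cherry_span_le (matching_card_le mM) _.
have [i ie /coveredP[e' e'M ie']] : exists2 i, i \in val e & i \in covered M.
  by apply: not_disjoint_shared; apply: contra nmeM; apply: matchingU1.
apply: cherry_span_matching (ie) (ie') => //.
by apply: contraNneq eM => ->.
Qed.

Lemma delta_reduction :
  cherry_span n./2 (\sum_i delta i * matching_system F (inl i) - 1).
Proof.
have -> : \sum_i delta i * matching_system F (inl i) - 1 =
    \sum_(M | is_matching M)
      (\sum_i delta_coef i M *: (matching_mono M * matching_system F (inl i))
       - (\sum_(e | (e \notin M) && is_matching (e |: M))
            (free_coef #|M| *+ 2) *: matching_mono (e |: M)
          - ((n - 2 * #|M|)%:R * free_coef #|M|) *: matching_mono M)).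
  rewrite sumrB; congr (_ - _).
    rewrite exchange_big; apply: eq_bigr => i _.
    by rewrite mulr_suml; apply: eq_bigr => M _; rewrite scalerAl.
  (* The terms are indexed by the larger matching [e |: M], whose size has predecessor |M|;
     [sum_matchingU1] then collects them. *)
  pose G M := (free_coef #|M|.-1 *+ 2) *: matching_mono M.
  rewrite sumrB (eq_bigr (fun M => \sum_(e | (e \notin M) && is_matching (e |: M)) G (e |: M))).
    (* By the balance only the empty matching survives, with coefficient 1 and monomial 1. *)
    rewrite sum_matchingU1 -sumrB (bigD1 set0) ?matching0 //= big1 => [|M /andP[mM M0]].
      rewrite addr0 /G scalerMnl -scalerBl free_coef_rec ?cards0 // scale1r.
      by rewrite /matching_mono /matching_mnm big_set0 mpolyX0.
    rewrite /G scalerMnl -scalerBl free_coef_rec ?matching_card_le //.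
    by rewrite cards_eq0 (negPf M0) scale0r.
  move=> M _; apply: eq_bigr => e /andP[eM _].
  by rewrite /G cardsU1 eM.
by apply: cherry_span_sum => M; apply: delta_matching_reduction.
Qed.

(** The upper bound is attained because the monomial of a matching of size [n./2] has a non-zero
    coefficient. *)
Lemma mpdeg_delta i : mpdeg (delta i) = n./2.
Proof.
have [M mM cM] := exists_matching (leqnn n./2).
have := delta_coef_neq0 i mM; rewrite -mcoeff_delta // -mcoeff_msupp => /msize_mdeg_lt.
rewrite mdeg_matching_mnm cM /mpdeg; have := msize_delta_le i.
by move: (msize _) => s; lia.
Qed.

Theorem exists_matching_certificate :
  exists c : 'I_n + cherry n -> poly, matching_certificate c.
Proof.
have [th thd E] := delta_reduction.
(* The Theta are the negated coefficients in the cherry expansion of the Delta part minus 1. *)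
exists (fun s => match s with inl i => delta i | inr t => - th t end); split.
- rewrite /nss_certificate big_sumType /=.
  under [X in _ + X]eq_bigr => t _ do rewrite mulNr.
  by rewrite sumrN -E opprB addrC subrK.
- by move=> i; rewrite mpdeg_delta matching_numberE.
- by move=> i M mM; rewrite mcoeff_delta ?delta_coef_neq0.
move=> t l; rewrite mpdeg_delta /mpdeg msizeN; have := thd t.
by move: (msize _) => s; lia.
Qed.

Lemma matching_certificate_degree (c : 'I_n + cherry n -> poly) :
  matching_certificate c -> nss_degree c = n./2.
Proof.
(* A vertex [i0] exists because n is odd; the degree of its Delta bounds those of all Theta. *)
case=> cert dD _ dT; have i0 : 'I_n by case: n n_odd => // k _; exact: ord0.
apply/eqP; rewrite eqn_leq certificate_degree_ge // andbT.
apply/bigmax_leqP => -[i|t] _; first by rewrite dD matching_numberE.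
by apply: leq_trans (dT t i0) _; rewrite dD matching_numberE.
Qed.

End Certificate.

(** * Infeasibility and minimality *)

Theorem theorem4p4 (F : fieldType) (n : nat)
    (F_char0 : [pchar F] =i pred0) (n_odd : odd n) :
  [/\ infeasible (@matching_system F n),
      matching_number n = n./2,
      exists c : 'I_n + cherry n -> {mpoly F[#|edge n|]},
        matching_certificate c,
      forall c : 'I_n + cherry n -> {mpoly F[#|edge n|]},
        matching_certificate c -> minimal_certificate (@matching_system F n) c
    & minimum_degree (@matching_system F n) n./2].
Proof.
have [c cP] := exists_matching_certificate F_char0 n_odd.
have [cert _ _ _] := cP.
have ge c' := @certificate_degree_ge F n F_char0 c'.
split=> //.
(* Evaluating a certificate at a common zero gives 1 = 0. *)
- case=> v v0; have /(congr1 (meval v)) := cert.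
  rewrite meval1 raddf_sum big1 => [/eqP|s _]; first by rewrite oner_eq0.
  by rewrite /= mevalM v0 mulr0.
- exact: matching_numberE.
- by exists c.
- move=> c' c'P; have [cert' _ _ _] := c'P; split=> // c'' /ge.
  by rewrite (matching_certificate_degree F_char0 n_odd c'P).
split=> //; exists c => //; exact: matching_certificate_degree.
Qed.
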